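(* Let $b\in L^1_{\rm loc}(\mathbb R^n)$ be real-valued, $\lambda\in(0,1)$, and $X$ be a ball Banach function space on $\mathbb R^n$ such that the Hardy--Littlewood maximal operator $\mathcal M$ is bounded on $X$. Let $\Omega\in L^\infty(\mathbb S^{n-1})$ be homogeneous of degree zero with $\int_{\mathbb S^{n-1}}\Omega\,d\sigma=0$, and suppose there exists an open set $\Lambda\subset\mathbb S^{n-1}$ such that $\Omega$ does not change sign on $\Lambda$. Let $\varepsilon_0\in(0,\infty)$ and $k_0\in(10\sqrt n,\infty)$. Then there exists a positive constant $C_{(\lambda,k_0,\varepsilon_0,n)}$, depending (for the given $X$) only on $\lambda$, $k_0$, $\varepsilon_0$ and $n$, such that the following holds. For any ball $B:=B(x_0,r_0)$ with $x_0\in\mathbb R^n$, $r_0\in(0,\infty)$, any point $x_1\in\mathbb R^n$ and sets $E,F,G$ forming an admissible configuration for $B$ (with respect to $b,\Omega,\lambda,\varepsilon_0,k_0$), and any measurable set $Q\subset\mathbb R^n$ with $|Q|\le\frac\lambda8|B(x_0,r_0)|$, $$\omega_\lambda(b;B)\,\|\mathbf 1_F\|_X\le C_{(\lambda,k_0,\varepsilon_0,n)}\,\big\|[b,T_\Omega](\mathbf 1_F)\,\mathbf 1_{E\setminus Q}\big\|_X.$$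
   Context: Ball Banach function space: let $\mathscr M(\mathbb R^n)$ be the set of all measurable functions on $\mathbb R^n$. A Banach space $X\subset\mathscr M(\mathbb R^n)$ (with $\|f\|_X=\infty$ for $f\notin X$) is a ball Banach function space if: $\|f\|_X=0$ implies $f=0$ a.e.; $|g|\le|f|$ a.e. implies $\|g\|_X\le\|f\|_X$; $0\le f_m\uparrow f$ a.e. implies $\|f_m\|_X\uparrow\|f\|_X$; $\mathbf 1_B\in X$ for every ball $B$; $\|f+g\|_X\le\|f\|_X+\|g\|_X$; and for every ball $B$ there is $C_{(B)}>0$ with $\int_B|f|\,dx\le C_{(B)}\|f\|_X$ for all $f\in X$. $\mathcal M(f)(x):=\sup_{B\ni x}\frac1{|B|}\int_B|f(y)|\,dy$, the supremum being over all balls $B$ containing $x$. $\mathbb S^{n-1}$ is the unit sphere with area measure $d\sigma$. Homogeneous of degree zero: $\Omega(\mu x)=\Omega(x)$ for $\mu\in(0,\infty)$, $x\in\mathbb S^{n-1}$, so $\Omega$ is defined on $\mathbb R^n\setminus\{0\}$. Local mean oscillation: $\omega_\lambda(f;B):=\inf_{c\in\mathbb C}\{[(f-c)\mathbf 1_B]^*(\lambda|B|)\}$, where $f^*(t):=\inf\{\alpha\in(0,\infty):|\{x\in\mathbb R^n:|f(x)|>\alpha\}|<t\}$. Admissible configuration for $B=B(x_0,r_0)$: a point $x_1\in\mathbb R^n$ with $|x_1-x_0|=2k_0r_0$ and measurable sets $E\subset B(x_0,r_0)$ with $|E|=\frac\lambda2|B(x_0,r_0)|$, $F\subset B(x_1,r_0)$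 with $|F|=\frac12|B(x_1,r_0)|$, and $G\subset E\times F$ with $|G|\ge\frac\lambda8|B(x_0,r_0)|^2$, such that: $\omega_\lambda(b;B)\le|b(x)-b(y)|$ for any $x\in E$ and $y\in F$; $\Omega(\frac{x-y}{|x-y|})$ and $b(x)-b(y)$ do not change sign on $E\times F$; and $|\Omega(\frac{x-y}{|x-y|})|\ge\varepsilon_0$ for any $(x,y)\in G$. $[b,T_\Omega]$ is the commutator $bT_\Omega(f)-T_\Omega(bf)$ of $b$ with the principal value singular integral $T_\Omega$ with kernel $\Omega(x-y)/|x-y|^n$; for a bounded measurable set $F$ and $x\notin\overline F$, $[b,T_\Omega](\mathbf 1_F)(x)=\int_F[b(x)-b(y)]\frac{\Omega(x-y)}{|x-y|^n}\,dy$. *)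

(* Defs.v *)
From HB Require Import structures.
From mathcomp Require Import all_boot all_order all_algebra.
From mathcomp Require Import complex.
From mathcomp Require Import all_classical all_reals all_analysis.

Set Implicit Arguments.
Unset Strict Implicit.
Unset Printing Implicit Defensive.

Import Order.TTheory GRing.Theory Num.Theory.
Import numFieldNormedType.Exports.

Local Open Scope classical_set_scope.
Local Open Scope ring_scope.

(* The Lebesgue measure on R^n is the completion (Caratheodory extension) of
   the n-fold product of the one-dimensional Lebesgue measure.  The product
   is built on n.-tuple R and then transported to 'rV[R]_n. *)

Lemma product_sigma_finite (R : realType) d1 d2 (T1 : measurableType d1)
    (T2 : measurableType d2) (m1 : {sigma_finite_measure set T1 -> \bar R})
    (m2 : {sigma_finite_measure set T2 -> \bar R}) :
  sigma_finite setT (m1 \x m2)%E.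
Proof.
have /sigma_finiteP[F [TF ndF Foo]] := sigma_finiteT m1.
have /sigma_finiteP[G [TG ndG Goo]] := sigma_finiteT m2.
exists (fun k => F k `*` G k).
  rewrite -setXTT TF TG predeqE => -[x y]; split.
    move=> [/= [i _ Fix] [j _ Gjy]]; exists (maxn i j) => //; split.
    - by move: x Fix; exact/subsetPset/ndF/leq_maxl.
    - by move: y Gjy; exact/subsetPset/ndG/leq_maxr.
  by move=> [i _ []/= ? ?]; split; exists i.
move=> k; have [? ?] := Foo k; have [? ?] := Goo k.
split; first exact: measurableX.
by rewrite product_measure1E// lte_mul_pinfty// ge0_fin_numE.
Qed.

Section tuple_lebesgue_step.
Context {R : realType} {n : nat}.
Local Notation T := (measurableTypeR R).
Variable m : {sigma_finite_measure set (n.-tuple T) -> \bar R}.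

Definition tuple_cons (p : T * n.-tuple T) : n.+1.-tuple T :=
  [the n.+1.-tuple T of p.1 :: p.2].

Lemma measurable_tuple_cons : measurable_fun [set: T * n.-tuple T] tuple_cons.
Proof.
apply: (@measurable_cons _ _ (T * n.-tuple T)%type T fst n snd).
  exact: measurable_fst.
exact: measurable_snd.
Qed.

Definition product_lebesgue_cons : set (n.+1.-tuple T) -> \bar R :=
  pushforward (@lebesgue_measure R \x m)%E tuple_cons.

Let product_lebesgue_cons0 : product_lebesgue_cons set0 = 0%E.
Proof. by rewrite /product_lebesgue_cons /pushforward preimage_set0 measure0. Qed.

Let product_lebesgue_cons_ge0 A : (0 <= product_lebesgue_cons A)%E.
Proof. exact: (measure_ge0 (@lebesgue_measure R \x m)%E). Qed.

Let product_lebesgue_cons_additive : semi_sigma_additive product_lebesgue_cons.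
Proof.
move=> F mF tF mUF; rewrite /product_lebesgue_cons /pushforward preimage_bigcup.
apply: measure_semi_sigma_additive.
- by move=> k; rewrite -[X in measurable X]setTI; exact: measurable_tuple_cons.
- apply/trivIsetP => /= i j _ _ ij; rewrite -preimage_setI.
  by move/trivIsetP : tF => /(_ _ _ _ _ ij) ->//; rewrite preimage_set0.
- rewrite -preimage_bigcup -[X in measurable X]setTI.
  exact: measurable_tuple_cons.
Qed.

HB.instance Definition _ := isMeasure.Build _ _ _ product_lebesgue_cons
  product_lebesgue_cons0 product_lebesgue_cons_ge0
  product_lebesgue_cons_additive.

Let product_lebesgue_cons_sigma_finite :
  sigma_finite setT product_lebesgue_cons.
Proof.
have [F TF mF] := product_sigma_finite (@lebesgue_measure R) m.
pose uncons (t : n.+1.-tuple T) : T * n.-tuple T :=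
  (thead t, [tuple of behead t]).
have unconsK : cancel uncons tuple_cons.
  by move=> t; rewrite [RHS]tuple_eta; apply: val_inj.
have consK : cancel tuple_cons uncons.
  by move=> [x t]; rewrite /uncons; congr pair; apply: val_inj.
have muncons : measurable_fun [set: n.+1.-tuple T] uncons.
  apply/measurable_fun_pair => /=; first exact: measurable_tnth.
  exact: measurable_behead.
exists (fun k => uncons @^-1` F k).
  by rewrite -preimage_bigcup -TF preimage_setT.
move=> k; have [mFk Fkoo] := mF k; split.
  by rewrite -[X in measurable X]setTI; exact: muncons.
rewrite /product_lebesgue_cons /pushforward.
suff -> : tuple_cons @^-1` (uncons @^-1` F k) = F k by [].
by apply/seteqP; split=> p /=; rewrite consK.
Qed.

HB.instance Definition _ := Measure_isSigmaFinite.Build _ _ _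
  product_lebesgue_cons product_lebesgue_cons_sigma_finite.

End tuple_lebesgue_step.

Fixpoint product_lebesgue (R : realType) (n : nat) :
    {sigma_finite_measure set (n.-tuple (measurableTypeR R)) -> \bar R} :=
  match n with
  | 0 => \d_([tuple] : 0.-tuple (measurableTypeR R))
  | n'.+1 => product_lebesgue_cons (product_lebesgue R n')
  end.

Section lebesgue_Rn.
Context {R : realType} {n : nat}.

Definition lebesgue_outer (A : set 'rV[R]_n) : \bar R :=
  ((product_lebesgue R n)^*)%mu
    [set t : n.-tuple R | A (\row_i tnth t i)].

Let lebesgue_outer0 : lebesgue_outer set0 = 0%E.
Proof. exact: (outer_measure0 ((product_lebesgue R n)^*)%mu). Qed.

Let lebesgue_outer_ge0 A : (0 <= lebesgue_outer A)%E.
Proof. exact: (outer_measure_ge0 ((product_lebesgue R n)^*)%mu). Qed.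

Let le_lebesgue_outer : {homo lebesgue_outer : A B / A `<=` B >-> (A <= B)%E}.
Proof.
move=> A B AB; apply: (le_outer_measure ((product_lebesgue R n)^*)%mu).
by move=> t; exact: AB.
Qed.

Let lebesgue_outer_subadditive : sigma_subadditive lebesgue_outer.
Proof.
by move=> F; exact: (outer_measure_sigma_subadditive
  ((product_lebesgue R n)^*)%mu (fun k => [set t | F k (\row_i tnth t i)])).
Qed.

HB.instance Definition _ := isOuterMeasure.Build R _ lebesgue_outer
  lebesgue_outer0 lebesgue_outer_ge0 le_lebesgue_outer
  lebesgue_outer_subadditive.

(* 'rV[R]_n equipped with the sigma-algebra of Lebesgue measurable sets. *)
Definition lebesgue_space := caratheodory_type lebesgue_outer.
HB.instance Definition _ := Measurable.on lebesgue_space.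

Definition lebesgue_Rn : set lebesgue_space -> \bar R := lebesgue_outer.

Let lebesgue_Rn0 : lebesgue_Rn set0 = 0%E.
Proof. exact: lebesgue_outer0. Qed.

Let lebesgue_Rn_ge0 A : (0 <= lebesgue_Rn A)%E.
Proof. exact: lebesgue_outer_ge0. Qed.

Let lebesgue_Rn_sigma_additive : semi_sigma_additive lebesgue_Rn.
Proof. exact: (@caratheodory_measure_sigma_additive _ _ lebesgue_outer). Qed.

HB.instance Definition _ := isMeasure.Build _ _ _ lebesgue_Rn
  lebesgue_Rn0 lebesgue_Rn_ge0 lebesgue_Rn_sigma_additive.

Let lebesgue_Rn_sigma_finite : sigma_finite setT lebesgue_Rn.
Proof.
have [F TF mF] := sigma_finiteT (product_lebesgue R n).
pose tup (v : 'rV[R]_n) : n.-tuple (measurableTypeR R) :=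
  [tuple v ord0 i | i < n].
have rowK (t : n.-tuple R) : tup (\row_i tnth t i) = t.
  by apply: eq_from_tnth => i; rewrite tnth_mktuple mxE.
have tupK (v : 'rV[R]_n) : \row_i tnth (tup v) i = v.
  by apply/rowP => i; rewrite mxE tnth_mktuple.
exists (fun k => [set v : 'rV[R]_n | F k (tup v)]).
  apply/seteqP; split=> // v _.
  by have : [set: n.-tuple _] (tup v) by []; rewrite TF.
have eqF k : [set t : n.-tuple R | F k (tup (\row_i tnth t i))] = F k.
  by apply/seteqP; split=> t /=; rewrite rowK.
move=> k; have [mFk Fkoo] := mF k; split; last first.
  by rewrite /lebesgue_Rn /lebesgue_outer /= eqF measurable_mu_extE.
move=> X; have := caratheodory_measurable_mu_ext (product_lebesgue R n) mFk.
move=> /(_ [set t : n.-tuple _ | X (\row_i tnth t i)]) XF.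
apply: (eq_trans XF); rewrite [LHS]/= [RHS]/= /lebesgue_outer.
by congr (_ + _)%E; congr mu_ext; apply/seteqP; split=> t /=; rewrite rowK.
Qed.

HB.instance Definition _ := Measure_isSigmaFinite.Build _ _ _ lebesgue_Rn
  lebesgue_Rn_sigma_finite.

End lebesgue_Rn.
Arguments lebesgue_space : clear implicits.
Arguments lebesgue_Rn : clear implicits.

Section euclidean.
Context {R : realType} {n : nat}.
Implicit Types x y : 'rV[R]_n.

(* The library norm on 'rV[R]_n is the maximum norm. *)
Definition enorm x : R := Num.sqrt (\sum_(i < n) x ord0 i ^+ 2).

Definition eball x (r : R) : set 'rV[R]_n := [set y | enorm (y - x) < r].

Definition esphere : set 'rV[R]_n := [set x | enorm x = 1].

Definition lmeasurable (A : set 'rV[R]_n) :=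
  measurable (A : set (lebesgue_space R n)).

Definition lmeasurable_fun (f : 'rV[R]_n -> R) :=
  measurable_fun [set: lebesgue_space R n] (f : lebesgue_space R n -> R).

Definition lmeasurable_cfun (f : 'rV[R]_n -> R[i]) :=
  lmeasurable_fun (fun x => complex.Re (f x)) /\
  lmeasurable_fun (fun x => complex.Im (f x)).

Definition locally_integrable_Rn (f : 'rV[R]_n -> R) :=
  lmeasurable_fun f /\
  forall K : set 'rV[R]_n, compact K ->
    (\int[lebesgue_Rn R n]_(x in K) `|(f x)%:E| < +oo)%E.

Definition lebesgue_Rn2 : set (lebesgue_space R n * lebesgue_space R n) -> \bar R :=
  ((lebesgue_Rn R n \x lebesgue_Rn R n)%E^*)%mu.

(* Lebesgue measurable subsets of R^n x R^n = R^(2n). *)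
Definition lmeasurable2 (G : set ('rV[R]_n * 'rV[R]_n)) :=
  lebesgue_Rn2.-caratheodory G.

End euclidean.
Arguments esphere : clear implicits.
Arguments lebesgue_Rn2 : clear implicits.

(* Area measure on the unit sphere, through polar coordinates:
   sigma(A) = n |{x : 0 < |x| <= 1, x/|x| \in A}|. It is carried by esphere. *)
Section area_measure.
Context {R : realType} {n : nat}.

Definition area_outer (A : set 'rV[R]_n) : \bar R :=
  (n%:R%:E * lebesgue_outer
     [set x : 'rV[R]_n | (0 < enorm x <= 1)%R /\ A ((enorm x)^-1 *: x)%R])%E.

Let area_outer0 : area_outer set0 = 0%E.
Proof.
rewrite /area_outer (_ : [set _ | _] = set0) ?outer_measure0 ?mule0//.
by apply/seteqP; split=> x // -[].
Qed.

Let area_outer_ge0 A : (0 <= area_outer A)%E.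
Proof. by rewrite mule_ge0 ?outer_measure_ge0// lee_fin. Qed.

Let le_area_outer : {homo area_outer : A B / A `<=` B >-> (A <= B)%E}.
Proof.
move=> A B AB; rewrite lee_wpmul2l ?lee_fin//.
by apply: le_outer_measure => x [? ?]; split=> //; exact: AB.
Qed.

Let area_outer_subadditive : sigma_subadditive area_outer.
Proof.
move=> F; rewrite /area_outer nneseriesZl; last first.
  by move=> k _; exact: outer_measure_ge0.
rewrite lee_wpmul2l ?lee_fin//.
apply: le_trans (outer_measure_sigma_subadditive _ _).
by apply: le_outer_measure => x [x01 [k _ Fkx]]; exists k.
Qed.

HB.instance Definition _ := isOuterMeasure.Build R _ area_outer
  area_outer0 area_outer_ge0 le_area_outer area_outer_subadditive.

Definition area_space := caratheodory_type area_outer.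
HB.instance Definition _ := Measurable.on area_space.

Definition area_measure : set area_space -> \bar R := area_outer.

Let area_measure0 : area_measure set0 = 0%E.
Proof. exact: area_outer0. Qed.

Let area_measure_ge0 A : (0 <= area_measure A)%E.
Proof. exact: area_outer_ge0. Qed.

Let area_measure_sigma_additive : semi_sigma_additive area_measure.
Proof. exact: (@caratheodory_measure_sigma_additive _ _ area_outer). Qed.

HB.instance Definition _ := isMeasure.Build _ _ _ area_measure
  area_measure0 area_measure_ge0 area_measure_sigma_additive.

End area_measure.
Arguments area_space : clear implicits.
Arguments area_measure : clear implicits.

Section function_spaces.
Context {R : realType} {n : nat}.
Implicit Types (f g : 'rV[R]_n -> R[i]) (N : ('rV[R]_n -> R[i]) -> \bar R).
Local Open Scope complex_scope.

Local Notation mu := (lebesgue_Rn R n).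

Definition cabs (z : R[i]) : R := complex.Re `|z|.

(* The space X is {f measurable | N f < +oo}; functions are identified when
   they are equal almost everywhere, which N cannot distinguish by
   bbfs_lattice. *)
Record ball_banach_function_space (X : set ('rV[R]_n -> R[i])) N : Prop := {
  bbfs_measurable : forall f, X f -> lmeasurable_cfun f;
  bbfs_finite : forall f, X f <-> (N f < +oo)%E;
  bbfs_norm_ge0 : forall f, (0 <= N f)%E;
  bbfs_zero : X (fun=> 0);
  bbfs_linear : forall (a : R[i]) f g,
    X f -> X g -> X (fun x => a * f x + g x);
  bbfs_normZ : forall (a : R[i]) f,
    X f -> N (fun x => a * f x) = ((cabs a)%:E * N f)%E;
  bbfs_complete : forall u : nat -> 'rV[R]_n -> R[i],
    (forall k, X (u k)) ->
    (forall e : R, 0 < e -> exists k0 : nat, forall j k : nat,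
      (k0 <= j)%N -> (k0 <= k)%N -> (N (fun x => u j x - u k x)%R < e%:E)%E) ->
    exists2 f, X f & N (fun x => u k x - f x) @[k --> \oo] --> 0%E;
  bbfs_definite : forall f, lmeasurable_cfun f -> N f = 0%E ->
    {ae mu, forall x, f x = 0};
  bbfs_lattice : forall f g, lmeasurable_cfun f -> lmeasurable_cfun g ->
    {ae mu, forall x, cabs (g x) <= cabs (f x)} -> (N g <= N f)%E;
  bbfs_monotone : forall (u : nat -> 'rV[R]_n -> R[i]) f,
    (forall k, lmeasurable_cfun (u k)) -> lmeasurable_cfun f ->
    {ae mu, forall x,
      [/\ forall k, 0 <= u k x, forall k, u k x <= u k.+1 x, 0 <= f x &
          complex.Re (u k x) @[k --> \oo] --> complex.Re (f x)]} ->
    (forall k, N (u k) <= N (u k.+1))%E /\ N (u k) @[k --> \oo] --> N f;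
  bbfs_ball : forall x (r : R), 0 < r -> X (\1_(eball x r));
  bbfs_triangle : forall f g, lmeasurable_cfun f -> lmeasurable_cfun g ->
    (N (fun x => f x + g x)%R <= N f + N g)%E;
  bbfs_integrable : forall x (r : R), 0 < r -> exists2 C : R, 0 < C &
    forall f, X f ->
      (\int[mu]_(y in eball x r) (cabs (f y))%:E <= C%:E * N f)%E
}.

Definition maximal f (x : 'rV[R]_n) : \bar R :=
  ereal_sup [set ((fine (mu (eball c.1 c.2)))^-1%:E *
                  \int[mu]_(y in eball c.1 c.2) (cabs (f y))%:E)%E
            | c in [set c : 'rV[R]_n * R | 0 < c.2 /\ eball c.1 c.2 x]].

(* Boundedness includes that the [0, +oo]-valued function maximal f is finite
   almost everywhere, hence defines an element of X. *)
Definition maximal_bounded (X : set ('rV[R]_n -> R[i])) N :=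
  exists2 C : R, 0 < C & forall f, X f ->
    {ae mu, forall x, (maximal f x < +oo)%E} /\
    (N (fun x => (fine (maximal f x))%:C) <= C%:E * N f)%E.

Definition rearrangement f (t : \bar R) : \bar R :=
  ereal_inf [set alpha%:E | alpha in
    [set alpha : R | 0 < alpha /\ (mu [set x | (alpha < cabs (f x))%R] < t)%E]].

Definition mean_oscillation (lambda : R) f (B : set 'rV[R]_n) : \bar R :=
  ereal_inf [set rearrangement (fun x => (f x - c) * \1_B x)
                   (lambda%:E * mu B)%E | c in [set: R[i]]].

End function_spaces.

Section rough_kernel.
Context {R : realType} {n : nat}.
Implicit Types (Omega b f : 'rV[R]_n -> R) (A : set 'rV[R]_n).

Definition homogeneous_degree0 Omega :=
  forall (t : R) x, 0 < t -> esphere R n x -> Omega (t *: x) = Omega x.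

Definition sphere_Linfty Omega :=
  measurable_fun (esphere R n : set (area_space R n))
    (Omega : area_space R n -> R) /\
  exists M : R, {ae area_measure R n, forall x, esphere R n x -> `|Omega x| <= M}.

Definition constant_sign (T : Type) (A : set T) (h : T -> R) :=
  (forall x, A x -> 0 <= h x) \/ (forall x, A x -> h x <= 0).

(* Principal value. *)
Definition T_Omega Omega f (x : 'rV[R]_n) : R :=
  lim ((\int[lebesgue_Rn R n]_(y in [set y | (e < enorm (x - y))%R])
          (Omega (x - y) / enorm (x - y) ^+ n * f y))%R @[e --> 0^'+]).

Definition commutator b Omega f (x : 'rV[R]_n) : R :=
  b x * T_Omega Omega f x - T_Omega Omega (fun y => b y * f y) x.

Local Notation dir x y := ((enorm (x - y))^-1 *: (x - y)).

Record admissible b Omega (lambda eps0 k0 : R) (x0 : 'rV[R]_n) (r0 : R)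
    (x1 : 'rV[R]_n) (E F : set 'rV[R]_n) (G : set ('rV[R]_n * 'rV[R]_n)) : Prop := {
  adm_dist : enorm (x1 - x0) = 2 * k0 * r0;
  adm_measurableE : lmeasurable E;
  adm_measurableF : lmeasurable F;
  adm_measurableG : lmeasurable2 G;
  adm_subE : E `<=` eball x0 r0;
  adm_subF : F `<=` eball x1 r0;
  adm_subG : G `<=` E `*` F;
  adm_volE : lebesgue_Rn R n E =
    ((lambda / 2)%:E * lebesgue_Rn R n (eball x0 r0))%E;
  adm_volF : lebesgue_Rn R n F =
    ((1 / 2)%:E * lebesgue_Rn R n (eball x1 r0))%E;
  adm_volG : ((lambda / 8)%:E * lebesgue_Rn R n (eball x0 r0) ^+ 2 <=
    lebesgue_Rn2 R n G)%E;
  adm_oscillation : forall x y, E x -> F y ->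
    (mean_oscillation lambda (fun z => (b z)%:C%C) (eball x0 r0) <=
     `|b x - b y|%:E)%E;
  adm_sign_Omega : constant_sign (E `*` F) (fun p => Omega (dir p.1 p.2));
  adm_sign_b : constant_sign (E `*` F) (fun p => b p.1 - b p.2);
  adm_lower : forall x y, G (x, y) -> eps0 <= `|Omega (dir x y)|
}.

End rough_kernel.

(* Main.v *)
(* For [x] in [E] away from [Q], the signs of [b x - b y] and [Omega (x - y)] are
   constant in [y \in F], so there is no cancellation in the integral
   [g x := [b, T_Omega](1_F)(x)], and |g x| is at least
   [omega_lambda(b; B) eps0 / (K r0)^n |G_x|], where [K = 2 k0 + 2] and [G_x] is
   the section of [G]. By Fubini, and since removing [Q x F] from [G] costs at
   most half of its measure, the integral of [|g|] over [E `\` Q] is at least a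
   multiple of [omega_lambda(b; B) r0^n]. As [E] and [F] lie in [B(x0, K r0)],
   the maximal function of [g 1_(E `\` Q)] is then at least a multiple of
   [omega_lambda(b; B)] on [F], and the boundedness of the maximal operator
   concludes. *)
Require Import Defs.
From mathcomp Require Import all_boot all_order all_algebra.
From mathcomp Require Import complex ring lra.
From mathcomp Require Import all_classical all_reals all_analysis.
From mathcomp Require Import measurable_realfun.

Import Order.TTheory GRing.Theory Num.Theory.
Import numFieldNormedType.Exports.

Local Open Scope classical_set_scope.
Local Open Scope ring_scope.

(** * Lebesgue measure under affine maps *)

Lemma measurable_affine (R : realType) (a v : R) :
  measurable_fun setT (fun x : measurableTypeR R => a * x + v : measurableTypeR R).
Proof. by apply: measurable_funD => //; exact: mulrl_measurable. Qed.

(** By uniqueness of Lebesgue measure: [|a|] times the image measure under the map gives every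
    half-open interval its length. *)
Lemma lebesgue_measure_affine (R : realType) (a v : R) (A : set (measurableTypeR R)) :
  a != 0 -> measurable A ->
  lebesgue_measure ((fun x : measurableTypeR R => a * x + v) @^-1` A) =
  (`|a|^-1%:E * lebesgue_measure A)%E.
Proof.
move=> a0 mA; have na0 : 0 < `|a| by rewrite normr_gt0.
pose f (x : measurableTypeR R) : measurableTypeR R := a * x + v.
pose mf : measurable_fun setT f := measurable_affine R a v.
pose m := mscale (NngNum (ltW na0)) (pushforward (@lebesgue_measure R) f).
rewrite (_ : lebesgue_measure A = m mf A); last first.
  apply: lebesgue_measure_unique => // _ [[p q] pq <-].
  change (lebesgue_measure `]p, q]%classic =
    (`|a|%:E * lebesgue_measure (f @^-1` `]p, q]%classic))%E).
  rewrite lebesgue_measure_itv/=.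
  have [a_gt0|a_lt0] : 0 < a \/ a < 0 by case/lt_total/orP: (a0) => ?; [right|left].
    rewrite (_ : _ @^-1` _ = `](p - v) / a, (q - v) / a]%classic); last first.
      apply/seteqP; split=> x /=; rewrite !in_itv/= /f ltr_pdivrMr// ler_pdivlMr//;
        by rewrite ltrBlDr lerBrDr mulrC.
    rewrite lebesgue_measure_itv/= !lte_fin ltr_pM2r ?invr_gt0// ltrD2r.
    case: ifP => _; last by rewrite mule0.
    rewrite -!EFinD -EFinM gtr0_norm//; congr EFin; field; exact: a0.
  (* A negative slope turns the half-open interval around, which leaves its length unaffected. *)
  rewrite (_ : _ @^-1` _ = `[(q - v) / a, (p - v) / a[%classic); last first.
    apply/seteqP; split=> x /=; rewrite !in_itv/= /f ler_ndivrMr// ltr_ndivlMr//;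
      by rewrite ltrBlDr lerBrDr mulrC andbC.
  rewrite lebesgue_measure_itv/= !lte_fin ltr_nM2r ?invr_lt0// ltrD2r.
  case: ifP => _; last by rewrite mule0.
  rewrite -!EFinD -EFinM ltr0_norm//; congr EFin; field; exact: a0.
by rewrite /m /mscale/= muleA -EFinM mulVf ?gt_eqF// mul1e.
Qed.

Definition tuple_affine {R : realType} {n : nat} (a : R) (v : 'I_n -> R)
    (t : n.-tuple (measurableTypeR R)) : n.-tuple (measurableTypeR R) :=
  [tuple a * tnth t i + v i | i < n].

Lemma measurable_tuple_affine (R : realType) (n : nat) (a : R) (v : 'I_n -> R) :
  measurable_fun setT (tuple_affine a v).
Proof.
apply/measurable_fun_tnthP => i.
rewrite (_ : _ \o _ = (fun x : measurableTypeR R => a * x + v i) \o (@tnth n _)^~ i).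
  by apply: measurableT_comp; [exact: measurable_affine|exact: measurable_tnth].
by apply/funext => t /=; rewrite tnth_mktuple.
Qed.

Lemma tuple_affine_cons (R : realType) (n : nat) (a : R) (v : 'I_n.+1 -> R)
    (p : measurableTypeR R * n.-tuple (measurableTypeR R)) :
  tuple_affine a v (tuple_cons p) =
  tuple_cons (a * p.1 + v ord0, tuple_affine a (v \o lift ord0) p.2).
Proof.
apply: eq_from_tnth => i; rewrite tnth_mktuple.
case: (unliftP ord0 i) => [j|] -> /=; last by rewrite !tnth0.
by rewrite !tnthS tnth_mktuple.
Qed.

(** Induction on the dimension by Fubini: the induction hypothesis scales the sections, and a change
    of variable in the first coordinate supplies the last factor [|a|^-1]. *)
Lemma product_lebesgue_affine (R : realType) (n : nat) (a : R) (v : 'I_n -> R)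
    (A : set (n.-tuple (measurableTypeR R))) : a != 0 -> measurable A ->
  product_lebesgue R n (tuple_affine a v @^-1` A) =
  ((`|a| ^- n)%:E * product_lebesgue R n A)%E.
Proof.
move=> a0; elim: n v A => [|n IH] v A mA.
  rewrite expr0 invr1 mul1e (_ : tuple_affine a v = id)//.
  by apply/funext => t; apply: eq_from_tnth => -[].
have mpre (B : set (n.+1.-tuple (measurableTypeR R))) :
    measurable B -> measurable (tuple_cons @^-1` B).
  by move=> mB; rewrite -[X in measurable X]setTI; exact: measurable_tuple_cons.
pose C := tuple_cons @^-1` A.
have mC : measurable C := mpre _ mA.
pose f (x : measurableTypeR R) : measurableTypeR R := a * x + v ord0.
have c0 : 0 <= `|a|^-1 by rewrite invr_ge0.
have cn0 : 0 <= `|a| ^- n by rewrite invr_ge0 exprn_ge0.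
change ((lebesgue_measure \x product_lebesgue R n)%E
   (tuple_cons @^-1` (tuple_affine a v @^-1` A)) = ((`|a| ^- n.+1)%:E *
   (lebesgue_measure \x product_lebesgue R n)%E C)%E).
have mphi := measurable_fun_xsection (product_lebesgue R n) mC.
transitivity (\int[lebesgue_measure]_x ((`|a| ^- n)%:E *
    product_lebesgue R n (xsection C (f x))))%E.
  apply: eq_integral => x _ /=; rewrite -(IH (v \o lift ord0)); last first.
    exact: measurable_xsection.
  congr (product_lebesgue R n _); apply/seteqP; split=> t;
    by rewrite /xsection /= !inE /C /= tuple_affine_cons.
rewrite ge0_integralZl//; last first.
  apply: (measurableT_comp mphi); exact: measurable_affine.
(* The integral of a function of [f x] is one against the image of Lebesgue measure under [f], which
   is [|a|^-1] times Lebesgue measure. *)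
rewrite -(@ge0_integral_pushforward _ _ _ _ _ _ (measurable_affine R a (v ord0))
  lebesgue_measure setT (product_lebesgue R n \o xsection C))//.
rewrite (eq_measure_integral (mscale (NngNum c0) lebesgue_measure)); first last.
- by move=> mf B mB _; exact: lebesgue_measure_affine.
- exact: measurable_affine.
rewrite ge0_integral_mscale// muleA -EFinM; congr (_%:E * _)%E.
by rewrite exprS invfM mulrC.
Qed.

(** The preimages of a measurable cover of [A] cover the preimage of [A], at [c] times the cost. *)
Lemma le_mu_ext_preimage (R : realType) d (T : measurableType d)
    (mu : {measure set T -> \bar R}) (f : T -> T) (c : R) (A : set T) :
  measurable_fun setT f -> 0 < c ->
  (forall B, measurable B -> mu (f @^-1` B) = (c%:E * mu B)%E) ->
  ((mu^*)%mu (f @^-1` A) <= c%:E * (mu^*)%mu A)%E.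
Proof.
move=> mf c0 muf; rewrite -lee_pdivrMl//; apply: le_ereal_inf_tmp => _ [B [mB AB] <-].
rewrite lee_pdivrMl// -nneseriesZl; last by move=> *; exact: measure_ge0.
apply: ereal_inf_lbound; exists (fun k => f @^-1` B k); last first.
  by apply: eq_eseriesr => k _; rewrite muf.
split=> [k|x /AB [k _ ?]]; last by exists k.
by rewrite -[X in measurable X]setTI; exact: mf.
Qed.

Section lebesgue_affine.
Context {R : realType} {n : nat}.
Implicit Types (A : set 'rV[R]_n) (v x y : 'rV[R]_n).

Lemma lebesgue_outer_affine (a : R) v A : a != 0 ->
  lebesgue_outer [set x | A (a *: x + v)] = ((`|a| ^- n)%:E * lebesgue_outer A)%E.
Proof.
have le_outer (b : R) (w : 'rV[R]_n) (B : set 'rV[R]_n) : b != 0 ->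
    (lebesgue_outer [set x | B (b *: x + w)%R] <= (`|b| ^- n)%:E * lebesgue_outer B)%E.
  move=> b0; rewrite /lebesgue_outer.
  rewrite (_ : [set t | _] = tuple_affine b (w ord0) @^-1`
    [set t | B (\row_i tnth t i)]); last first.
    apply/seteqP; split=> t /=; congr (B _); apply/rowP => i;
      by rewrite !mxE tnth_mktuple.
  apply: le_mu_ext_preimage; first exact: measurable_tuple_affine.
    by rewrite invr_gt0 exprn_gt0// normr_gt0.
  by move=> C mC; exact: product_lebesgue_affine.
move=> a0; apply/eqP; rewrite eq_le le_outer//=.
have an0 : 0 < `|a| ^+ n by rewrite exprn_gt0// normr_gt0.
rewrite -lee_pdivlMl ?invr_gt0// invrK.
(* The reverse inequality is [le_outer] for the inverse affine map, applied to the preimage of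
   [A]. *)
have := le_outer a^-1 (- (a^-1 *: v)) [set x | A (a *: x + v)].
rewrite invr_eq0 normfV -exprVn invrK => /(_ a0); apply: le_trans.
rewrite le_eqVlt; apply/orP; left; apply/eqP; congr lebesgue_outer.
apply/seteqP; split=> x /=;
  by rewrite -scalerBr scalerA divff// scale1r subrK.
Qed.

Lemma caratheodory_affine (a : R) v A : a != 0 ->
  lebesgue_outer.-caratheodory A ->
  lebesgue_outer.-caratheodory [set x | A (a *: x + v)].
Proof.
move=> a0 mA Z; pose Y := [set y : 'rV[R]_n | Z (a^-1 *: (y - v))].
have ZE (B : set 'rV[R]_n) :
    Z `&` [set x | B (a *: x + v)] = [set x | (Y `&` B) (a *: x + v)].
  by apply/seteqP; split=> x /=; rewrite /Y/= addrK scalerA mulVf// scale1r.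
have -> : ~` [set x | A (a *: x + v)] = [set x | (~` A) (a *: x + v)] by [].
have ZY : Z = [set x : 'rV[R]_n | Y (a *: x + v)] by rewrite -[LHS]setIT (ZE setT) setIT.
rewrite !ZE {1}ZY !(lebesgue_outer_affine a v _ a0) -ge0_muleDr ?outer_measure_ge0//.
by rewrite -mA.
Qed.

Lemma lebesgue_outer_setT : lebesgue_outer [set: 'rV[R]_n] != 0%E.
Proof.
rewrite /lebesgue_outer (_ : [set t | _] = setT)//.
rewrite measurable_mu_extE//; elim: n => [|m IH] /=.
  by rewrite diracE in_setT eqe oner_eq0.
rewrite /product_lebesgue_cons /pushforward preimage_setT -setXTT.
rewrite product_measure1E// mule_eq0 (negbTE IH) orbF.
have /= := lebesgue_measure_itv (`]0%R, 1%R[%R : interval R).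
rewrite lte_fin ltr01 => itv01; apply/eqP => T0.
have : (lebesgue_measure (`]0%R, 1%R[%classic : set (measurableTypeR R)) <= 0)%E.
  by rewrite -T0 le_measure// inE.
by rewrite itv01 -EFinB subr0 lee_fin ler10.
Qed.

End lebesgue_affine.

(** * The Euclidean norm and the volume of balls *)

Section euclidean_norm.
Context {R : realType} {n : nat}.
Implicit Types x y z : 'rV[R]_n.

Lemma enorm_ge0 x : 0 <= enorm x.
Proof. exact: sqrtr_ge0. Qed.

Lemma sqr_enorm x : enorm x ^+ 2 = \sum_(i < n) x ord0 i ^+ 2.
Proof. by rewrite sqr_sqrtr// sumr_ge0// => i _; exact: sqr_ge0. Qed.

Lemma enormZ (a : R) x : enorm (a *: x) = `|a| * enorm x.
Proof.
rewrite /enorm -sqrtr_sqr -sqrtrM ?sqr_ge0// mulr_sumr; congr Num.sqrt.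
by apply: eq_bigr => i _; rewrite mxE exprMn.
Qed.

Lemma enormN x : enorm (- x) = enorm x.
Proof. by rewrite -scaleN1r enormZ normrN1 mul1r. Qed.

Lemma enorm_sub x y : enorm (x - y) = enorm (y - x).
Proof. by rewrite -enormN opprB. Qed.

Lemma enorm0_eq0 x : enorm x = 0 -> x = 0.
Proof.
move=> x0; have /eqP := sqr_enorm x; rewrite x0 expr0n/= eq_sym psumr_eq0; last first.
  by move=> i _; exact: sqr_ge0.
move=> /allP x0'; apply/rowP => i; rewrite mxE.
by have := x0' i; rewrite mem_index_enum => /(_ isT)/=; rewrite sqrf_eq0 => /eqP.
Qed.

Lemma enorm_triangle x y : enorm (x + y) <= enorm x + enorm y.
Proof.
have [/enorm0_eq0 ->|x0] := eqVneq (enorm x) 0.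
  by rewrite add0r lerDr enorm_ge0.
have [/enorm0_eq0 ->|y0] := eqVneq (enorm y) 0.
  by rewrite addr0 lerDl enorm_ge0.
have xp : 0 < enorm x by rewrite lt0r x0 enorm_ge0.
have yp : 0 < enorm y by rewrite lt0r y0 enorm_ge0.
rewrite -(@ler_pXn2r _ 2)// ?nnegrE ?addr_ge0 ?enorm_ge0//.
pose c := enorm y / enorm x.
have c0 : 0 < c by rewrite divr_gt0.
(* AM-GM: [2 s t <= c s^2 + t^2 / c] with [c = |y| / |x|] *)
apply: (@le_trans _ _ (\sum_(i < n)
    ((1 + c) * x ord0 i ^+ 2 + (1 + c^-1) * y ord0 i ^+ 2))).
  rewrite sqr_enorm; apply: ler_sum => i _; rewrite mxE -subr_ge0.
  set s := x _ _; set t := y _ _.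
  rewrite (_ : _ - _ = c^-1 * (c * s - t) ^+ 2); last by field; rewrite gt_eqF.
  by rewrite mulr_ge0 ?sqr_ge0// invr_ge0 ltW.
rewrite big_split/= -!mulr_sumr -!sqr_enorm le_eqVlt; apply/orP; left; apply/eqP.
by rewrite /c; field; rewrite x0 y0.
Qed.

Lemma eball_affine x (r : R) : 0 < r ->
  eball x r = [set y | eball 0 1 (r^-1 *: y + (- (r^-1 *: x)))].
Proof.
move=> r0; apply/seteqP; split=> y; rewrite /eball /= subr0 -scalerBr enormZ;
  by rewrite gtr0_norm ?invr_gt0// mulrC ltr_pdivrMr// mul1r.
Qed.

Lemma lebesgue_eball x (r : R) : 0 < r ->
  lebesgue_Rn R n (eball x r) =
  ((r ^+ n)%:E * lebesgue_Rn R n (eball (0 : 'rV[R]_n) 1))%E.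
Proof.
move=> r0; rewrite (eball_affine x r r0) /lebesgue_Rn.
rewrite lebesgue_outer_affine ?invr_eq0 ?gt_eqF//.
by rewrite gtr0_norm ?invr_gt0// exprVn invrK.
Qed.

(** If the unit ball were null, so would be all its dilates, and they exhaust the space, which is
    not null. *)
Lemma lebesgue_unit_eball_gt0 : (0 < lebesgue_Rn R n (eball (0 : 'rV[R]_n) 1))%E.
Proof.
rewrite lt_neqAle measure_ge0 andbT; apply/eqP => /esym v0.
have /eqP[] := @lebesgue_outer_setT R n.
apply/eqP; rewrite eq_le outer_measure_ge0 andbT.
rewrite (_ : setT = \bigcup_k eball (0 : 'rV[R]_n) k.+1%:R); last first.
  apply/seteqP; split=> // x _; exists (Num.truncn (enorm x)) => //.
  by rewrite /eball/= subr0 truncnS_gt.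
apply: (le_trans (outer_measure_sigma_subadditive _ _)).
rewrite eseries0// => k _ _.
by have := lebesgue_eball 0 k.+1%:R (ltr0Sn R k); rewrite v0 mule0.
Qed.

End euclidean_norm.

(** * Measurable approximation of Caratheodory measurable sets *)

Section measurable_hull.
Context {R : realType} {d} {T : measurableType d} (mu : {measure set T -> \bar R}).
Implicit Types A P : set T.

(** The intersection over [k] of covers of [A] with excess at most [1/(k+1)]; when the outer measure
    is infinite, the whole space will do. *)
Lemma measurable_hull A :
  exists H, [/\ measurable H, A `<=` H & mu H = (mu^*)%mu A].
Proof.
have [Aoo|Aoo] := eqVneq ((mu^*)%mu A) +oo%E.
  exists setT; split=> //; apply/eqP; rewrite eq_le Aoo leey/=.
  by rewrite -Aoo -measurable_mu_extE// le_outer_measure.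
have Afin : (mu^*)%mu A \is a fin_num.
  by rewrite ge0_fin_numE ?outer_measure_ge0// ltey.
have /choice[H HP] (k : nat) : exists H, [/\ measurable H, A `<=` H &
    (mu H <= (mu^*)%mu A + (k.+1%:R^-1)%:E)%E].
  have k0 : 0 < k.+1%:R^-1 :> R by rewrite invr_gt0.
  have [_ [B [mB AB] <-] Bk] := lb_ereal_inf_adherent k0 Afin.
  exists (\bigcup_i B i); split=> //; first exact: bigcupT_measurable.
  apply: le_trans (ltW Bk); apply: measure_sigma_subadditive => //.
  exact: bigcupT_measurable.
exists (\bigcap_k H k); split.
- by apply: bigcapT_measurable => k; have [] := HP k.
- by move=> x Ax k _; have [_ + _] := HP k; exact.
apply/eqP; rewrite eq_le; apply/andP; split; last first.
  rewrite -measurable_mu_extE; last first.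
    by apply: bigcapT_measurable => k; have [] := HP k.
  apply: le_outer_measure => x Ax k _; by have [_ + _] := HP k; exact.
apply/lee_addgt0Pr => e e0.
pose k := Num.truncn e^-1.
have [mH AH Hk] := HP k.
apply: (@le_trans _ _ (mu (H k))).
  apply: le_measure; rewrite ?inE//; last exact: bigcap_inf.
  by apply: bigcapT_measurable => j; have [] := HP j.
apply: (le_trans Hk); rewrite leeD2l// lee_fin invf_ple ?posrE//.
by rewrite ltW// truncnS_gt.
Qed.

(** This is the inner measure criterion: the hypothesis says that the inner measure of [A] within
    [P], namely the measure of [P] minus the outer measure of its complement in [P], equals its
    outer measure. *)
Lemma caratheodory_of_additive A P :
  (mu^*)%mu.-caratheodory P -> A `<=` P -> ((mu^*)%mu P < +oo)%E ->
  ((mu^*)%mu A + (mu^*)%mu (P `\` A))%E = (mu^*)%mu P ->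
  (mu^*)%mu.-caratheodory A.
Proof.
move=> mP AP Poo APE.
have [H [mH AH HE]] := measurable_hull A.
have [H' [mH' AH' HE']] := measurable_hull (P `\` A).
have fin B : B `<=` P -> (mu^*)%mu B \is a fin_num.
  move=> BP; rewrite ge0_fin_numE ?outer_measure_ge0//.
  by rewrite (le_lt_trans _ Poo)// le_outer_measure.
have finH : mu H \is a fin_num by rewrite HE fin.
have finH' : mu H' \is a fin_num by rewrite HE' fin// => x [].
have finI : mu (H `&` H') \is a fin_num.
  rewrite ge0_fin_numE// (@le_lt_trans _ _ (mu H))//; last by rewrite ltey_eq finH.
  by rewrite le_measure ?inE//; exact: measurableI.
(* [H] and [H'] cover [P] with no excess measure, so they only overlap on a
   null set, and [A] differs from [P `\` H'] by a subset of it. *)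
have I0 : mu (H `&` H') = 0%E.
  have : (mu H + mu H' <= mu (H `|` H'))%E.
    rewrite HE HE' APE -measurable_mu_extE; last exact: measurableU.
    apply: le_outer_measure => x Px; have [Ax|nAx] := pselect (A x).
      by left; exact: AH.
    by right; exact: AH'.
  rewrite measureUfinr ?ltey_eq ?finH'// leeBrDr//.
  rewrite -leeBrDl ?fin_numD ?finH// subee ?fin_numD ?finH//.
  by move=> I0; apply/eqP; rewrite eq_le I0 measure_ge0.
have -> : A = (P `\` H') `|` (A `&` (H `&` H')).
  apply/seteqP; split=> [x Ax|x [[Px H'x]|[]//]].
    have [H'x|H'x] := pselect (H' x); last by left; split=> //; exact: AP.
    by right; split=> //; split=> //; exact: AH.
  by apply: contrapT => nAx; apply: H'x; exact: AH'.
apply: caratheodory_measurable_setU.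
  apply: caratheodory_measurable_setD => //.
  exact: caratheodory_measurable_mu_ext.
apply: (@measure_is_complete_caratheodory R T (mu^*)%mu).
exists (H `&` H'); split; last by move=> x [].
  by apply: caratheodory_measurable_mu_ext; exact: measurableI.
by rewrite /= measurable_mu_extE//; exact: measurableI.
Qed.

(** Dual to [measurable_hull]: remove from [D] a hull of [D \ A]. It serves to replace a set that is
    only Lebesgue measurable in the product by one with measurable sections. *)
Lemma measurable_inner_set A D : (mu^*)%mu.-caratheodory A -> measurable D ->
  A `<=` D -> (mu D < +oo)%E ->
  exists B, [/\ measurable B, B `<=` A & ((mu^*)%mu A <= mu B)%E].
Proof.
move=> mA mD AD Doo; have [H [mH DAH HE]] := measurable_hull (D `\` A).
exists (D `\` H); split; first exact: measurableD.
  by move=> x [Dx Hx]; apply: contrapT => Ax; apply: Hx; exact: DAH.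
have H_fin : mu H \is a fin_num.
  rewrite HE ge0_fin_numE ?outer_measure_ge0//; apply: le_lt_trans Doo.
  by rewrite -measurable_mu_extE// le_outer_measure.
rewrite -(leeD2rE _ _ H_fin) {1}HE.
have -> : ((mu^*)%mu A + (mu^*)%mu (D `\` A))%E = mu D.
  by rewrite -(measurable_mu_extE mu mD) (mA D) setIidr.
rewrite (measureDI mu mD mH).
by rewrite leeD2l// le_measure ?inE//; exact: measurableI.
Qed.

End measurable_hull.

(** * Lebesgue measurable sets and functions on the row vectors *)

Section lebesgue_measurability.
Context {R : realType} {n : nat}.
Implicit Types (A P S : set 'rV[R]_n) (x : 'rV[R]_n).

Let tup x : n.-tuple (measurableTypeR R) := [tuple x ord0 i | i < n].

Let rowK : cancel (fun t : n.-tuple R => \row_i tnth t i) tup.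
Proof. by move=> t; apply: eq_from_tnth => i; rewrite tnth_mktuple mxE. Qed.

Lemma lmeasurable_tupleP A :
  lmeasurable A <->
  ((product_lebesgue R n)^*)%mu.-caratheodory [set t | A (\row_i tnth t i)].
Proof.
split=> mA.
  move=> Z; have := mA [set x | Z (tup x)]; rewrite /lebesgue_outer.
  congr (_ = _ + _)%E; congr mu_ext; apply/seteqP; split=> t /=; by rewrite rowK.
by move=> Z; exact: (mA [set t | Z (\row_i tnth t i)]).
Qed.

Lemma lmeasurable_of_additive A P : lmeasurable P -> A `<=` P ->
  (lebesgue_outer P < +oo)%E ->
  (lebesgue_outer A + lebesgue_outer (P `\` A))%E = lebesgue_outer P ->
  lmeasurable A.
Proof.
move=> /lmeasurable_tupleP mP AP Poo APE; apply/lmeasurable_tupleP.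
apply: caratheodory_of_additive mP _ Poo APE.
by move=> t; exact: AP.
Qed.

Lemma lmeasurable_coord (i : 'I_n) : lmeasurable_fun (fun x => x ord0 i).
Proof.
move=> _ Y mY; rewrite setTI; apply/lmeasurable_tupleP.
apply: caratheodory_measurable_mu_ext.
rewrite (_ : [set t | _] = (fun t : n.-tuple (measurableTypeR R) => tnth t i) @^-1` Y).
  by rewrite -[X in measurable X]setTI; exact: measurable_tnth.
by apply/seteqP; split=> t; rewrite /preimage/= mxE.
Qed.

Lemma lmeasurable_enorm x : lmeasurable_fun (fun y => enorm (y - x)).
Proof.
apply: (@measurableT_comp _ _ _ _ _ _ (@Num.sqrt R)).
  apply: continuous_measurable_fun; exact: sqrt_continuous.
apply: measurable_sum => i; apply: measurable_funX.
rewrite (_ : (fun _ => _) = (fun y : 'rV[R]_n => y ord0 i - x ord0 i)); last first.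
  by apply/funext => y; rewrite !mxE.
exact: (measurable_funB (lmeasurable_coord i) (measurable_cst (x ord0 i))).
Qed.

Lemma lmeasurable_eball x (r : R) : lmeasurable (eball x r).
Proof.
have := @lmeasurable_enorm x measurableT `]-oo, r[%classic (measurable_itv _).
by rewrite setTI; congr measurable; apply/seteqP; split=> y /=; rewrite in_itv.
Qed.

Lemma lmeasurable_closed_eball x (r : R) :
  lmeasurable [set y | enorm (y - x) <= r].
Proof.
have := @lmeasurable_enorm x measurableT `]-oo, r]%classic (measurable_itv _).
by rewrite setTI; congr measurable; apply/seteqP; split=> y /=; rewrite in_itv.
Qed.

End lebesgue_measurability.

(** * Functions of the direction, from the sphere to the space *)

Section spherical_functions.
Context {R : realType} {n : nat}.
Hypotheses (n0 : (0 < n)%N)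
  (ball_finite : forall r : R, (lebesgue_Rn R n (eball (0 : 'rV[R]_n) r) < +oo)%E).
Implicit Types (S F : set 'rV[R]_n) (x y : 'rV[R]_n).

(** The truncated cone over [S]; [area_outer S] is [n] times its outer measure. *)
Let cone S := [set x : 'rV[R]_n | (0 < enorm x <= 1) /\ S ((enorm x)^-1 *: x)].

(** The cone over the complement of the sphere is empty, as [x / |x|] is always a unit vector. *)
Lemma area_measurable_esphere :
  measurable (esphere R n : set (area_space R n)).
Proof.
move=> Z; rewrite /area_outer -ge0_muleDr ?outer_measure_ge0//; congr (_ * _)%E.
rewrite [X in (_ + X)%E](_ : _ = 0%E); last first.
  rewrite (_ : [set _ | _] = set0) ?outer_measure0//.
  apply/seteqP; split=> x //= -[/andP[x0 _] [_]]; apply.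
  by rewrite /esphere/= enormZ gtr0_norm ?invr_gt0// mulVf// gt_eqF.
rewrite adde0; congr lebesgue_outer.
apply/seteqP; split=> x /= [x01]; last by move=> [].
split=> //; split=> //; have /andP[x0 _] := x01.
by rewrite /esphere/= enormZ gtr0_norm ?invr_gt0// mulVf// gt_eqF.
Qed.

(* The Caratheodory criterion for [area_outer] only tests [cone S] against
   cones; testing it against the whole punctured ball is enough. *)
Lemma lmeasurable_cone S :
  measurable (S : set (area_space R n)) -> lmeasurable (cone S).
Proof.
move=> mS; apply: (@lmeasurable_of_additive _ _ _ (cone setT)).
- rewrite (_ : cone setT = [set y | enorm (y - 0) <= 1] `\` [set y | enorm (y - 0) <= 0]).
    by apply: measurableD; exact: lmeasurable_closed_eball.
  apply/seteqP; split=> x; rewrite /cone/= subr0.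
    by move=> [/andP[x0 ->] _]; split=> //; apply/negP; rewrite -ltNge.
  by move=> [-> /negP]; rewrite -ltNge => ->.
- by move=> x [].
- apply: le_lt_trans (ball_finite 2); apply: le_outer_measure => x [/andP[_ x1] _].
  by rewrite /eball/= subr0 (le_lt_trans x1)// ltr1n.
(* For the test set [setT], the Caratheodory identity of [S] is [n] times the additivity required
   here. *)
have := mS setT; rewrite /area_outer -ge0_muleDr ?outer_measure_ge0//.
rewrite !setTI => /eqP; rewrite eq_le !lee_pmul2l ?lte_fin ?ltr0n// -eq_le.
move=> /eqP ->; congr (_ + lebesgue_outer _)%E.
apply/seteqP; split=> x /= [x01 nSx]; last by split=> // -[].
by have [? _] := x01; split=> // Sx; apply: nSx.
Qed.

Let dir x y : 'rV[R]_n := (enorm (x - y))^-1 *: (x - y).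

(** Dividing [x - y] by [r] brings it into the unit ball without changing its direction, so a
    condition on the direction becomes the affine preimage of a cone. *)
Let coneE S x y (r : R) : 0 < r -> 0 < enorm (x - y) <= r ->
  cone S (- r^-1 *: y + r^-1 *: x) <-> S (dir x y).
Proof.
move=> r0 /andP[xy0 xyr]; rewrite /cone/= scaleNr addrC -scalerBr enormZ.
rewrite gtr0_norm ?invr_gt0// mulr_gt0 ?invr_gt0//= mulrC ler_pdivrMr// mul1r xyr.
rewrite scalerA invfM invrK -mulrA mulfV ?gt_eqF// mulr1.
by split=> [[]//|].
Qed.

(** Within [F], the preimage of [Y] is an affine preimage of the cone over the part of the sphere
    that [Omega] sends into [Y]. *)
Lemma measurable_dir (Omega : 'rV[R]_n -> R) F x (r : R) :
  measurable_fun (esphere R n : set (area_space R n))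
    (Omega : area_space R n -> R) -> lmeasurable F -> 0 < r ->
  (forall y, F y -> 0 < enorm (x - y) <= r) ->
  measurable_fun (F : set (lebesgue_space R n))
    (fun y : lebesgue_space R n => Omega (dir x y)).
Proof.
move=> mO mF r0 Fr _ Y mY.
pose S := esphere R n `&` Omega @^-1` Y.
have mS : measurable (S : set (area_space R n)).
  by apply: mO => //; exact: area_measurable_esphere.
rewrite (_ : F `&` _ =
    F `&` [set y : 'rV[R]_n | cone S (- r^-1 *: y + r^-1 *: x)]).
  apply: measurableI => //; apply: caratheodory_affine.
    by rewrite oppr_eq0 invr_eq0 gt_eqF.
  exact: lmeasurable_cone.
apply/seteqP; split=> y [Fy /= Yy]; split=> //=.
  apply/coneE => //; first exact: Fr.
  split=> //; rewrite /esphere/= enormZ gtr0_norm ?invr_gt0; last first.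
    by have /andP[] := Fr _ Fy.
  by rewrite mulVf// gt_eqF//; have /andP[] := Fr _ Fy.
by have /coneE[] := Yy => //; exact: Fr.
Qed.

(** The cone over an exceptional set of area zero is null, and an affine preimage of it contains all
    the bad points of [F]. *)
Lemma ae_dir (Q : 'rV[R]_n -> Prop) F x (r : R) : 0 < r ->
  (forall y, F y -> 0 < enorm (x - y) <= r) ->
  {ae area_measure R n, forall z, esphere R n z -> Q z} ->
  {ae lebesgue_Rn R n, forall y, F y -> Q (dir x y)}.
Proof.
move=> r0 Fr [A [mA A0 QA]].
exists [set y : 'rV[R]_n | cone A (- r^-1 *: y + r^-1 *: x)]; split.
- apply: caratheodory_affine; first by rewrite oppr_eq0 invr_eq0 gt_eqF.
  exact: lmeasurable_cone.
- change (lebesgue_outer [set y : 'rV[R]_n | cone A (- r^-1 *: y + r^-1 *: x)] = 0%E).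
  rewrite lebesgue_outer_affine ?oppr_eq0 ?invr_eq0 ?gt_eqF//.
  have /eqP : area_outer A = 0%E by [].
  by rewrite mule_eq0 eqe pnatr_eq0 gtn_eqF//= => /eqP ->; rewrite mule0.
move=> y /= /not_implyP[Fy nQ]; apply/coneE => //; first exact: Fr.
apply: QA => /=; apply/not_implyP; split=> //.
rewrite /esphere/= enormZ gtr0_norm ?invr_gt0; last by have /andP[] := Fr _ Fy.
by rewrite mulVf// gt_eqF//; have /andP[] := Fr _ Fy.
Qed.

End spherical_functions.

(** * Commutators applied to indicator functions *)

Lemma integrable_ae_bounded_mul (R : realType) d (T : measurableType d)
    (mu : {measure set T -> \bar R}) (F : set T) (h g : T -> R) (M : R) :
  measurable F -> measurable_fun F h ->
  {ae mu, forall y, F y -> `|h y| <= M} ->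
  mu.-integrable F (EFin \o g) ->
  mu.-integrable F (fun y => (h y * g y)%:E).
Proof.
move=> mF mh hM ig; have mg := measurable_int mu ig.
have mg' : measurable_fun F g by apply/measurable_EFinP.
have mhg : measurable_fun F (fun y => (h y * g y)%:E).
  by apply/measurable_EFinP; exact: measurable_funM.
apply/integrableP; split=> //.
apply: (@le_lt_trans _ _ (\int[mu]_(y in F) (`|M|%:E * `|(g y)%:E|))%E).
  apply: ae_ge0_le_integral => //.
  - exact: measurableT_comp.
  - by apply: measurable_funeM; exact: measurableT_comp.
  have [N [mN N0 hN]] := hM; exists N; split=> // y /= Hy; apply: hN => /= Hy'.
  apply: Hy => Fy; rewrite -EFinM lee_fin normrM ler_wpM2r//.
  exact: le_trans (Hy' Fy) (ler_norm _).
rewrite ge0_integralZl//; last exact: measurableT_comp.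
by rewrite lte_mul_pinfty//; case/integrableP : ig.
Qed.

Section commutator_of_indicator.
Context {R : realType} {n : nat}.
Hypotheses (n0 : (0 < n)%N)
  (ball_finite : forall x (r : R), (lebesgue_Rn R n (eball x r) < +oo)%E).
Local Notation mu := (lebesgue_Rn R n).
Implicit Types (b Omega g : 'rV[R]_n -> R) (A F : set 'rV[R]_n) (x y : 'rV[R]_n).

Lemma integrable_locally b F x (r : R) : locally_integrable_Rn b ->
  lmeasurable F -> F `<=` eball x r -> mu.-integrable F (EFin \o b).
Proof.
move=> [mb bK] mF Fr.
(* The closed cube around the ball is compact as a product of segments. *)
pose K : set 'rV[R]_n := [set y | forall i, `[x ord0 i - r, x ord0 i + r]%classic (y ord0 i)].
have cK : compact K.
  apply: (@rV_compact _ _ (fun i => `[x ord0 i - r, x ord0 i + r]%classic)) => i.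
  exact: segment_compact.
have mK : measurable (K : set (lebesgue_space R n)).
  rewrite (_ : K = \bigcap_(i in [set: 'I_n])
      [set y | `[x ord0 i - r, x ord0 i + r]%classic (y ord0 i)]); last first.
    by apply/seteqP; split=> y /= Ky i; [move=> _|]; exact: Ky.
  apply: fin_bigcap_measurable; first exact: finite_finset.
  move=> i _; have := @lmeasurable_coord R n i measurableT _
    (measurable_itv `[x ord0 i - r, x ord0 i + r]).
  by rewrite setTI.
have FK : F `<=` K.
  move=> y /Fr yr i; rewrite /= in_itv/= -ler_distlC distrC.
  apply: le_trans (ltW yr); rewrite -sqrtr_sqr ler_sqrt ?sumr_ge0//; last first.
    by move=> j _; exact: sqr_ge0.
  rewrite (bigD1 i)//= !mxE lerDl sumr_ge0// => j _; exact: sqr_ge0.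
apply: (@integrableS _ _ _ mu K) => //.
apply/integrableP; split; last exact: bK.
by apply/measurable_EFinP; exact: measurable_funS mb.
Qed.

(** A truncation at [d <= e] removes no point of [F], so the truncated integrals are constant near
    [0] and so is their limit. *)
Lemma T_Omega_away Omega g F x (e : R) : 0 < e ->
  (forall y, F y -> e < enorm (x - y)) ->
  T_Omega Omega (fun y => g y * \1_F y) x =
  \int[mu]_(y in F) (Omega (x - y) / enorm (x - y) ^+ n * g y).
Proof.
move=> e0 Fe; rewrite /T_Omega; apply: lim_near_cst => //.
near=> d.
rewrite Rintegral_mkcond [RHS]Rintegral_mkcond; apply: eq_Rintegral => y _.
rewrite /patch indicE; case: ifPn => [_|/negP yd].
  by case: ifPn => _; rewrite ?mulr1 ?mulr0.
case: ifPn => // yF; exfalso; apply: yd; rewrite inE/=.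
apply: le_lt_trans (Fe _ (set_mem yF)); near: d; exact: nbhs_right_le.
Unshelve. all: by end_near. Qed.

Variables (b Omega : 'rV[R]_n -> R) (F : set 'rV[R]_n) (x : 'rV[R]_n) (e L : R).
Hypotheses (bloc : locally_integrable_Rn b) (Omega0 : homogeneous_degree0 Omega)
  (OmegaLoo : sphere_Linfty Omega) (mF : lmeasurable F)
  (Fball : exists x1 r1, F `<=` eball x1 r1) (e0 : 0 < e)
  (Fe : forall y, F y -> e < enorm (x - y) <= L).

Let k y := Omega (x - y) / enorm (x - y) ^+ n.
Let dir y : 'rV[R]_n := (enorm (x - y))^-1 *: (x - y).

Let Fgt0 y : F y -> 0 < enorm (x - y).
Proof. by move=> /Fe/andP[+ _]; exact: lt_trans. Qed.

Lemma homogeneous_dir y : 0 < enorm (x - y) -> Omega (x - y) = Omega (dir y).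
Proof.
move=> xy0; rewrite -(Omega0 (enorm (x - y)) (dir y))//.
  by rewrite /dir scalerA divff ?scale1r// gt_eqF.
by rewrite /esphere/= enormZ gtr0_norm ?invr_gt0// mulVf// gt_eqF.
Qed.

(** On [F] the kernel is bounded almost everywhere by [|M| / e^n], where [M] bounds [Omega] almost
    everywhere on the sphere. *)
Lemma integrable_kernel g : mu.-integrable F (EFin \o g) ->
  mu.-integrable F (fun y => (k y * g y)%:E).
Proof.
case: OmegaLoo => mO [M OM] ig.
have L0 (y : 'rV[R]_n) : F y -> 0 < L.
  by move=> Fy; apply: lt_le_trans (Fgt0 _ Fy) _; have /andP[] := Fe _ Fy.
(* [|L| + 1] is a positive bound even if [F] is empty, when [L] may be negative. *)
have FL y : F y -> 0 < enorm (x - y) <= `|L| + 1.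
  move=> Fy; rewrite Fgt0//=; have /andP[_ xyL] := Fe _ Fy.
  by rewrite (le_trans xyL)// (le_trans (ler_norm _))// lerDl.
have L1 : 0 < `|L| + 1 by rewrite ltr_wpDl.
apply: (@integrable_ae_bounded_mul _ _ _ mu F k g (`|M| / e ^+ n)) => //.
- rewrite (_ : k = (fun y => Omega (x - y)) \* (fun y => (enorm (x - y)) ^- n))//.
  apply: measurable_funM.
    apply: (eq_measurable_fun (fun y : lebesgue_space R n => Omega (dir y))).
      by move=> y; rewrite inE => Fy; rewrite homogeneous_dir// Fgt0.
    exact: (measurable_dir n0 (ball_finite 0) _ _ _ _ mO mF L1 FL).
  rewrite (_ : (fun _ => _) = (@powR R ^~ (- n%:R)) \o (fun y => enorm (y - x))).
    apply: measurableT_comp; first exact: measurable_powR.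
    apply: measurable_funTS; exact: lmeasurable_enorm.
  by apply/funext => y /=; rewrite powR_invn ?enorm_ge0// enorm_sub.
have [N [mN N0 hN]] := ae_dir n0 (ball_finite 0) _ F x _ L1 FL OM; exists N; split=> // y /= Hy; apply: hN => /= Hy'.
apply: Hy => Fy; have xy0 := Fgt0 _ Fy.
rewrite /k homogeneous_dir// normrM normfV normrX [`|enorm _|]ger0_norm ?enorm_ge0//.
rewrite ler_pM ?invr_ge0 ?exprn_ge0 ?enorm_ge0//.
  exact: le_trans (Hy' Fy) (ler_norm _).
rewrite lef_pV2 ?posrE ?exprn_gt0// lerXn2r ?nnegrE ?enorm_ge0// ltW//.
by have /andP[] := Fe _ Fy.
Qed.

Let F_finite : (mu F < +oo)%E.
Proof.
have [x1 [r1 Fx1]] := Fball; apply: le_lt_trans (ball_finite x1 r1).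
by rewrite le_measure// inE//; exact: lmeasurable_eball.
Qed.

Let integrable_b : mu.-integrable F (EFin \o b).
Proof. by have [x1 [r1 Fx1]] := Fball; exact: integrable_locally Fx1. Qed.

Let integrable_diff : mu.-integrable F (fun y => (b x - b y)%:E).
Proof.
have ibx : mu.-integrable F (EFin \o cst (b x)).
  apply: measurable_bounded_integrable => //.
  by exists `|b x|; split; [exact: num_real|move=> M M0 y _; exact: ltW].
by have := integrableB mF ibx integrable_b.
Qed.

Lemma commutator_indic : commutator b Omega \1_F x =
  \int[mu]_(y in F) (k y * (b x - b y)).
Proof.
have i1 : mu.-integrable F (EFin \o (cst 1 : _ -> R)).
  apply: measurable_bounded_integrable => //.
  by exists 1; split=> // M M1 y _; rewrite /= normr1 ltW.
(* Both arguments of [T_Omega] are brought to the form [g y * \1_F y], with [g] equal to [1] and to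
   [b]. *)
rewrite /commutator (_ : \1_F = fun y => cst 1 y * \1_F y); last first.
  by apply/funext => y; rewrite mul1r.
rewrite !(T_Omega_away Omega _ F x e)//; first last.
- by move=> y /Fe/andP[].
rewrite (_ : (fun y => b y * _) = fun y => b y * \1_F y); last first.
  by apply/funext => y; rewrite mul1r.
rewrite (T_Omega_away Omega _ F x e)//; last by move=> y /Fe/andP[].
rewrite -RintegralZl//; last exact: integrable_kernel.
rewrite -RintegralB//; first last.
- exact: integrable_kernel.
- by have := integrableZl mF (b x) (integrable_kernel (cst 1) i1).
by apply: eq_Rintegral => y _; rewrite -/(k y) mulr1 mulrBr mulrC.
Qed.

Lemma commutator_indic_ge A (w eps : R) : lmeasurable A -> A `<=` F ->
  0 <= w -> 0 < eps ->
  constant_sign F (fun y => Omega (dir y)) ->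
  constant_sign F (fun y => b x - b y) ->
  (forall y, A y -> w <= `|b x - b y|) ->
  (forall y, A y -> eps <= `|Omega (dir y)|) ->
  ((w * eps / L ^+ n)%:E * mu A <= `|commutator b Omega \1_F x|%:E)%E.
Proof.
move=> mA AF w0 eps0 sO sb wA epsA.
pose h y := k y * (b x - b y).
have ih : mu.-integrable F (EFin \o h) by exact: integrable_kernel.
have inh : mu.-integrable F (EFin \o (fun y => `|h y|)) by exact: integrable_norm.
(* The sign [s] of the integrand is the product of the constant signs of [Omega] and of [b x - b y];
   it leaves the integral, so the modulus of the integral is the integral of [|h|]. *)
have [s s1 hs] : exists2 s : R, `|s| = 1 & forall y, F y -> h y = s * `|h y|.
  have kE y : F y -> k y = Omega (dir y) / enorm (x - y) ^+ n.
    by move=> Fy; rewrite /k homogeneous_dir// Fgt0.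
  have [s1 s11 s1P] : exists2 s : R, `|s| = 1 & forall y, F y -> k y = s * `|k y|.
    case: sO => sO; [exists 1|exists (-1)]; rewrite ?normrN ?normr1// => y Fy.
      by rewrite mul1r ger0_norm// kE// divr_ge0 ?sO// exprn_ge0// enorm_ge0.
    rewrite mulN1r ler0_norm ?opprK// kE// mulr_le0_ge0 ?sO//.
    by rewrite invr_ge0 exprn_ge0// enorm_ge0.
  have [s2 s21 s2P] : exists2 s : R, `|s| = 1 &
      forall y, F y -> b x - b y = s * `|b x - b y|.
    case: sb => sb; [exists 1|exists (-1)]; rewrite ?normrN ?normr1// => y Fy.
      by rewrite mul1r ger0_norm// sb.
    by rewrite mulN1r ler0_norm ?opprK// sb.
  exists (s1 * s2); first by rewrite normrM s11 s21 mulr1.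
  by move=> y Fy; rewrite /h normrM {1}s1P// {1}s2P//; ring.
rewrite commutator_indic (_ : \int[mu]_(y in F) _ = \int[mu]_(y in F) (s * `|h y|)).
  2: by apply: eq_Rintegral => y; rewrite inE => /hs.
rewrite RintegralZl// normrM s1 mul1r ger0_norm ?Rintegral_ge0//.
rewrite /Rintegral fineK; last exact: integrable_fin_num.
have mh : measurable_fun (F : set (lebesgue_space R n)) (fun y => (`|h y|)%:E) by exact: (measurable_int mu).
(* The integral of [|h|] is then restricted to [A], where [|h|] is at least [w * eps / L^n]. *)
apply: (@le_trans _ _ (\int[mu]_(y in A) `|h y|%:E)%E); last first.
  by apply: ge0_subset_integral => //; move=> y _; rewrite lee_fin.
rewrite -(integral_cst mu mA); apply: ge0_le_integral; first exact: mA.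
- move=> y Ay; rewrite lee_fin divr_ge0 ?mulr_ge0 ?(ltW eps0)// exprn_ge0//.
  have Fy := AF _ Ay; rewrite (le_trans (ltW (Fgt0 _ Fy)))//.
  by have /andP[] := Fe _ Fy.
- exact: measurable_cst.
- exact: (measurable_funS mF AF mh).
move=> y Ay; have Fy := AF _ Ay; have xy0 := Fgt0 _ Fy.
have /andP[_ xyL] := Fe _ Fy.
rewrite lee_fin /h /k homogeneous_dir//.
rewrite !normrM normfV normrX [`|enorm _|]ger0_norm ?enorm_ge0//.
have Lp : 0 < L by exact: lt_le_trans xyL.
rewrite -[w * eps * _]mulrA [w * (_ * _)]mulrC; apply: ler_pM => //; last exact: wA.
  by rewrite divr_ge0 ?exprn_ge0// ltW.
apply: ler_pM; [exact: ltW|by rewrite invr_ge0 exprn_ge0// ltW|exact: epsA|].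
by rewrite lef_pV2 ?posrE ?exprn_gt0// lerXn2r ?nnegrE ?enorm_ge0// ltW.
Qed.

End commutator_of_indicator.

(** * Ball Banach function spaces *)

Lemma cabs_real (R : realType) (r : R) : cabs (r%:C)%C = `|r|.
Proof. by rewrite /cabs normc_def /= expr0n addr0 sqrtr_sqr. Qed.

Section ball_banach.
Context {R : realType} {n : nat} {X : set ('rV[R]_n -> R[i])}
  {N : ('rV[R]_n -> R[i]) -> \bar R}.
Hypothesis hX : ball_banach_function_space X N.
Local Notation mu := (lebesgue_Rn R n).
Implicit Types (F : set 'rV[R]_n) (x : 'rV[R]_n).

(** The volume of a ball is the integral of its indicator, which the integrability axiom bounds by a
    multiple of its finite norm. This provides the hypothesis [ball_finite] of the preceding
    sections. *)
Lemma bbfs_eball_finite x (r : R) : (mu (eball x r) < +oo)%E.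
Proof.
have [r0|r0] := leP r 0.
  rewrite (_ : eball x r = set0) ?measure0//.
  apply/seteqP; split=> y //; rewrite /eball/= => /lt_le_trans/(_ r0).
  by rewrite ltNge enorm_ge0.
have [C C0 CP] := bbfs_integrable hX x r0.
have Xb := bbfs_ball hX x r0.
apply: (@le_lt_trans _ _ (C%:E * N \1_(eball x r))%E); last first.
  by rewrite lte_mul_pinfty// ?lee_fin ?(ltW C0)//; apply/(bbfs_finite hX).
apply: le_trans (CP _ Xb).
rewrite -[leLHS]mul1e -integral_cst; last exact: lmeasurable_eball.
rewrite le_eqVlt; apply/orP; left; apply/eqP/eq_integral => y yb.
by rewrite indicE yb /cabs normr1.
Qed.

Lemma lmeasurable_cfun_real (f : 'rV[R]_n -> R) :
  lmeasurable_fun f -> lmeasurable_cfun (fun x => (f x)%:C%C).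
Proof. by move=> mf; split=> //=; exact: measurable_cst. Qed.

Lemma indic_complex F : (\1_F : 'rV[R]_n -> R[i]) = fun x => (\1_F x : R)%:C%C.
Proof. by apply/funext => x; rewrite !indicE; case: (x \in F). Qed.

Lemma lmeasurable_cfun_indic F : lmeasurable F ->
  lmeasurable_cfun (\1_F : 'rV[R]_n -> R[i]).
Proof.
move=> mF; rewrite indic_complex; apply: lmeasurable_cfun_real.
exact: measurable_indic.
Qed.

Lemma bbfs_indic F x (r : R) : 0 < r -> lmeasurable F -> F `<=` eball x r ->
  X \1_F.
Proof.
move=> r0 mF Fr; apply/(bbfs_finite hX).
apply: (@le_lt_trans _ _ (N \1_(eball x r))); last first.
  by apply/(bbfs_finite hX)/(bbfs_ball hX).
apply: (bbfs_lattice hX).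
- by apply: lmeasurable_cfun_indic; exact: lmeasurable_eball.
- exact: lmeasurable_cfun_indic.
apply/aeW => y; rewrite !indic_complex !cabs_real !ger0_norm ?indic_ge0//.
rewrite !indicE ler_nat; case: (boolP (y \in F)) => // /set_mem /Fr yr.
by rewrite mem_set.
Qed.

Lemma maximal_ge (f : 'rV[R]_n -> R[i]) z (r : R) x : 0 < r -> eball z r x ->
  ((fine (mu (eball z r)))^-1%:E * \int[mu]_(y in eball z r) (cabs (f y))%:E
    <= maximal f x)%E.
Proof. by move=> r0 zx; apply: ereal_sup_ubound; exists (z, r). Qed.

(** Almost everywhere, [s] times the indicator of [F] is below the maximal function, so the lattice
    property and the maximal bound compare the norms. *)
Lemma bbfs_maximal_indic (C : R) F z (r s : R) (f : 'rV[R]_n -> R[i]) :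
  (forall f, X f -> {ae mu, forall x, (maximal f x < +oo)%E} /\
    (N (fun x => (fine (maximal f x))%:C%C) <= C%:E * N f)%E) ->
  0 < r -> lmeasurable F -> F `<=` eball z r -> X f -> 0 <= s ->
  (forall x, F x -> (s%:E <= maximal f x)%E) ->
  (s%:E * N \1_F <= C%:E * N f)%E.
Proof.
move=> MC r0 mF Fr Xf s0 sM; have [Moo NM] := MC _ Xf; apply: le_trans (NM).
have XF := bbfs_indic _ _ _ r0 mF Fr.
have := bbfs_normZ hX (s%:C)%C XF; rewrite cabs_real ger0_norm// => <-.
(* Having a finite norm, the maximal function lies in [X], hence is measurable. *)
have XM : X (fun x => (fine (maximal f x))%:C%C).
  apply/(bbfs_finite hX); apply: le_lt_trans NM _.
  have /(bbfs_finite hX) Nf := Xf.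
  (* The sign of [C] is arbitrary here; if [C <= 0], the bound is at most [0], hence finite. *)
  case: (leP C 0) => C0; last by rewrite lte_mul_pinfty// lee_fin ltW.
  rewrite (@le_lt_trans _ _ 0%E)//.
  by rewrite mule_le0_ge0 ?lee_fin//; exact: (bbfs_norm_ge0 hX).
apply: (bbfs_lattice hX); first exact: (bbfs_measurable hX XM).
  rewrite indic_complex (_ : (fun _ => _) = fun x => (s * \1_F x)%:C%C); last first.
    by apply/funext => x; rewrite rmorphM.
  apply: lmeasurable_cfun_real; apply: measurable_funM; first exact: measurable_cst.
  exact: measurable_indic.
(* Finiteness almost everywhere matters because [fine] sends [+oo] to [0]. *)
have [A [mA A0 MA]] := Moo; exists A; split=> // x /= Hx; apply: MA => /= Mx.
apply: Hx; rewrite indic_complex -rmorphM !cabs_real indicE.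
case: (boolP (x \in F)) => [/set_mem Fx|_]; last by rewrite mulr0 normr0 normr_ge0.
rewrite mulr1 ger0_norm// (le_trans _ (ler_norm _))// -lee_fin fineK ?sM//.
by rewrite fin_numElt Mx (lt_le_trans _ (sM _ Fx))// ltNyr.
Qed.

End ball_banach.

(** * Fubini for the sections of an admissible configuration *)

Section product_sections.
Context {R : realType} {n : nat}.
Local Notation mu := (lebesgue_Rn R n).
Implicit Types E F Q : set 'rV[R]_n.

(** Here [beta] stands for the volume of a ball of radius [r0]. The product [Q x F] has measure at
    most [(lambda / 8 * beta) * (beta / 2)], half of the lower bound on [G], so the other half
    survives its removal. *)
Lemma admissible_sections E F Q (G : set ('rV[R]_n * 'rV[R]_n)) (lambda beta : R) :
  lmeasurable E -> lmeasurable F -> lmeasurable Q -> lmeasurable2 G ->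
  G `<=` E `*` F -> 0 <= lambda -> 0 <= beta ->
  (mu E < +oo)%E -> mu F = (beta / 2)%:E ->
  (mu Q <= (lambda / 8 * beta)%:E)%E ->
  ((lambda / 8 * beta ^+ 2)%:E <= lebesgue_Rn2 R n G)%E ->
  exists H : set (lebesgue_space R n * lebesgue_space R n),
    [/\ measurable H, H `<=` G, (forall p, H p -> ~ Q p.1) &
      ((lambda / 16 * beta ^+ 2)%:E <= (mu \x mu)%E H)%E].
Proof.
move=> mE mF mQ mG GEF l0 b0 Eoo FE Qle Gge.
have mEF : measurable (E `*` F : set (lebesgue_space R n * lebesgue_space R n)).
  exact: measurableX.
have mQF : measurable (Q `*` F : set (lebesgue_space R n * lebesgue_space R n)).
  exact: measurableX.
have EFoo : ((mu \x mu)%E (E `*` F) < +oo)%E.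
  have E0 : (0 <= mu E)%E by exact: measure_ge0.
  by rewrite product_measure1E//= FE lte_mul_pinfty ?ltry// ge0_fin_numE.
have [G' [mG' GG' GleG']] := measurable_inner_set (mu \x mu)%E _ _ mG mEF GEF EFoo.
exists (G' `\` (Q `*` F)); split.
- exact: measurableD.
- by move=> p [/GG'].
- move=> p [/GG' /GEF[Ep Fp] nQF] Qp; exact: nQF.
have QFle : ((mu \x mu)%E (G' `&` (Q `*` F)) <= (lambda / 16 * beta ^+ 2)%:E)%E.
  apply: (@le_trans _ _ ((mu \x mu)%E (Q `*` F))).
    by rewrite le_measure ?inE//; exact: measurableI.
  rewrite product_measure1E//= FE.
  apply: (@le_trans _ _ ((lambda / 8 * beta)%:E * (beta / 2)%:E)%E).
    by rewrite lee_wpmul2r// lee_fin divr_ge0.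
  by rewrite -EFinM lee_fin le_eqVlt; apply/orP; left; apply/eqP; field.
have := le_trans Gge GleG'; rewrite (measureDI (mu \x mu)%E mG' mQF) => le8.
rewrite -(@leeD2rE _ (lambda / 16 * beta ^+ 2)%:E)//.
apply: le_trans (leeD2l _ QFle); apply: le_trans le8.
by rewrite -EFinD lee_fin le_eqVlt; apply/orP; left; apply/eqP; field.
Qed.

(** Fubini; the sections over points outside [E] are empty, so integrating over [E] loses
    nothing. *)
Lemma product_measure_sections_le (H : set (lebesgue_space R n * lebesgue_space R n))
    E (c : R) (f : 'rV[R]_n -> R) :
  measurable H -> lmeasurable E -> (forall p, H p -> E p.1) -> 0 <= c ->
  measurable_fun (E : set (lebesgue_space R n)) (f : lebesgue_space R n -> R) ->
  (forall x, E x -> (c%:E * mu (xsection H x) <= (f x)%:E)%E) ->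
  (c%:E * (mu \x mu)%E H <= \int[mu]_(x in E) (f x)%:E)%E.
Proof.
move=> mH mE HE c0 mf fge.
have mphi := measurable_fun_xsection mu mH.
rewrite (_ : (mu \x mu)%E H = \int[mu]_(x in E) mu (xsection H x))%E; last first.
  rewrite [RHS]integral_mkcond; apply: eq_integral => x _.
  rewrite /patch; case: ifPn => // /negP xE.
  rewrite /= (_ : xsection H x = set0) ?measure0//.
  by apply/seteqP; split=> y //; rewrite /xsection/= inE => /HE/= Ex; apply: xE; rewrite inE.
have mphiE : measurable_fun (E : set (lebesgue_space R n)) (mu \o xsection H).
  exact: measurable_funTS mphi.
have phi0 x : E x -> (0 <= (mu \o xsection H) x)%E by move=> _; exact: measure_ge0.
rewrite -[leLHS](ge0_integralZl mu mE mphiE phi0); last by rewrite lee_fin.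
apply: ge0_le_integral; first exact: mE.
- by move=> x Ex; apply: mule_ge0; [rewrite lee_fin|exact: phi0].
- exact: measurable_funeM mphiE.
- exact/measurable_EFinP.
- exact: fge.
Qed.

End product_sections.

(** * The norm estimate for the commutator *)

Lemma mean_oscillation_ge0 (R : realType) (n : nat) (lambda : R)
    (f : 'rV[R]_n -> R[i]) (B : set 'rV[R]_n) :
  (0 <= mean_oscillation lambda f B)%E.
Proof.
apply: le_ereal_inf_tmp => _ [c _ <-]; apply: le_ereal_inf_tmp => _ [a [a0 _] <-].
by rewrite lee_fin ltW.
Qed.

Theorem proposition3p14 (R : realType) (n : nat) (hn : (0 < n)%N)
  (X : set ('rV[R]_n -> R[i])) (N : ('rV[R]_n -> R[i]) -> \bar R)
  (hX : ball_banach_function_space X N) (hM : maximal_bounded X N)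
  (lambda : R) (hlambda : 0 < lambda < 1)
  (eps0 : R) (heps0 : 0 < eps0)
  (k0 : R) (hk0 : 10 * Num.sqrt n%:R < k0) :
  exists2 C : R, 0 < C &
    forall (b Omega : 'rV[R]_n -> R),
      locally_integrable_Rn b ->
      homogeneous_degree0 Omega ->
      sphere_Linfty Omega ->
      (\int[area_measure R n]_(x in esphere R n) (Omega x)%:E = 0)%E ->
      (exists2 U : set 'rV[R]_n, open U &
        constant_sign (U `&` esphere R n) Omega) ->
    forall (x0 : 'rV[R]_n) (r0 : R) (x1 : 'rV[R]_n) (E F : set 'rV[R]_n)
        (G : set ('rV[R]_n * 'rV[R]_n)) (Q : set 'rV[R]_n),
      0 < r0 ->
      admissible b Omega lambda eps0 k0 x0 r0 x1 E F G ->
      lmeasurable Q ->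
      (lebesgue_Rn R n Q <=
        (lambda / 8)%:E * lebesgue_Rn R n (eball x0 r0))%E ->
      (mean_oscillation lambda (fun x => (b x)%:C%C) (eball x0 r0) *
         N (\1_F) <=
       C%:E * N (fun x =>
         (commutator b Omega (\1_F) x * \1_(E `\` Q) x)%:C%C))%E.
Proof.
have [CM CM0 MC] := hM.
have /andP[l0 _] := hlambda.
have ball_finite := bbfs_eball_finite hX.
pose v := fine (lebesgue_Rn R n (eball (0 : 'rV[R]_n) 1)).
have vE : lebesgue_Rn R n (eball (0 : 'rV[R]_n) 1) = v%:E.
  by rewrite fineK// ge0_fin_numE// ball_finite.
have v0 : 0 < v by rewrite -lte_fin -vE; exact: lebesgue_unit_eball_gt0.
have k10 : 10 < k0.
  apply: le_lt_trans hk0; rewrite ler_peMr//.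
  by rewrite -[leLHS]sqrtr1 ler_sqrt// ler1n.
(* For [x] in [E] and [y] in [F], the distance is at most [2 k0 r0], between the centres, plus two
   radii [r0]. *)
pose K := 2 * k0 + 2.
have K0 : 0 < K by rewrite /K; lra.
(* Product of the pointwise factor [eps0 / (K r0)^n] and the measure [lambda / 16 * (r0^n v)^2] of
   [H], divided by the volume [(K r0)^n v] of the ball in the maximal function; all powers of [r0]
   cancel. *)
pose c := eps0 * lambda * v / (16 * (K ^+ n * K ^+ n)).
have c0 : 0 < c by rewrite divr_gt0 ?mulr_gt0 ?exprn_gt0.
exists (CM / c); first exact: divr_gt0.
move=> b Omega bloc Om0 Omoo _ _ x0 r0 x1 E F G Q r00 adm mQ Qle.
set g := (X in (_ <= _ * N X)%E).
have [dist01 mE mF mG EB FB GEF volE volF volG oscle sO sb epsG] := adm.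
pose L := K * r0; pose beta := r0 ^+ n * v.
have L0 : 0 < L by rewrite mulr_gt0.
have beta0 : 0 < beta by rewrite mulr_gt0 ?exprn_gt0.
have ballE (x : 'rV[R]_n) : lebesgue_Rn R n (eball x r0) = beta%:E.
  by rewrite lebesgue_eball// vE.
(* From below, the distance is at least [2 k0 r0 - 2 r0], which exceeds [r0] as [10 < k0]. *)
have distE x y : E x -> F y -> r0 < enorm (x - y) <= L.
  move=> /EB xB /FB yB; rewrite /eball/= in xB yB.
  have h1 := enorm_triangle (x1 - y) (y - x0).
  have h2 := enorm_triangle (y - x) (x - x0).
  have h3 := enorm_triangle (x - x0) (x0 - x1).
  have h4 := enorm_triangle (x - x1) (x1 - y).
  move: h1 h2 h3 h4; rewrite !addrA !subrK dist01 (enorm_sub x0) dist01.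
  rewrite (enorm_sub x1 y) (enorm_sub y x) /L /K => h1 h2 h3 h4.
  have : 10 * r0 < k0 * r0 by rewrite ltr_pM2r.
  by move: xB yB h1 h2 h3 h4 => *; apply/andP; split; nra.
have FB' : F `<=` eball x0 L.
  move=> y /FB; rewrite /eball/= => yx1.
  have := enorm_triangle (y - x1) (x1 - x0); rewrite addrA subrK dist01 /L /K.
  by nra.
have EB' : E `<=` eball x0 L.
  move=> y /EB; rewrite /eball/= => /lt_trans; apply.
  by rewrite /L /K ltr_pMl//; lra.
(* One point in each of [E] and [F] bounds the oscillation by [|b x - b y|], so it is a real number
   [w]. *)
have [x xE] : E !=set0.
  apply/set0P/eqP => E0; move: volE; rewrite E0 measure0 ballE -EFinM => -[].
  by apply/eqP; rewrite lt_eqF// mulr_gt0// divr_gt0.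
have [y yF] : F !=set0.
  apply/set0P/eqP => F0; move: volF; rewrite F0 measure0 ballE -EFinM => -[].
  by apply/eqP; rewrite lt_eqF// mulr_gt0// divr_gt0.
set osc := mean_oscillation _ _ _.
have osc0 : (0 <= osc)%E by exact: mean_oscillation_ge0.
pose w := fine osc.
have wE : osc = w%:E.
  by rewrite fineK// ge0_fin_numE// (le_lt_trans (oscle _ _ xE yF))// ltry.
have w0 : 0 <= w by rewrite -lee_fin -wE.
(* If the norm of [g] is infinite, the right side is [+oo]. Otherwise [g] belongs to [X], which also
   makes it measurable. *)
have [Ng|Ng] := eqVneq (N g) +oo%E.
  by rewrite Ng gt0_muley ?leey// lte_fin divr_gt0.
have Xg : X g by apply/(bbfs_finite hX); rewrite ltey.
have [H [mH HG HQ volH]] : exists H : set (lebesgue_space R n * lebesgue_space R n),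
    [/\ measurable H, H `<=` G, (forall p, H p -> ~ Q p.1) &
      ((lambda / 16 * beta ^+ 2)%:E <= (lebesgue_Rn R n \x lebesgue_Rn R n)%E H)%E].
  apply: (admissible_sections E F) => //.
  - exact: ltW.
  - exact: ltW.
  - by rewrite volE ballE ltry.
  - by rewrite volF ballE -EFinM; congr EFin; rewrite mul1r mulrC.
  - by rewrite EFinM -(ballE x0).
  - by rewrite EFinM EFin_expe -(ballE x0).
have mball : lmeasurable (eball x0 L) by exact: lmeasurable_eball.
pose h z := commutator b Omega \1_F z * \1_(E `\` Q) z.
have mh : lmeasurable_fun h by have [] := bbfs_measurable hX Xg.
pose d := w * eps0 / L ^+ n.
have d0 : 0 <= d by rewrite divr_ge0 ?mulr_ge0 ?exprn_ge0 // ltW.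
have int_ge : ((d * (lambda / 16 * beta ^+ 2))%:E <=
    \int[lebesgue_Rn R n]_(z in eball x0 L) (cabs (g z))%:E)%E.
  apply: (@le_trans _ _ (d%:E * (lebesgue_Rn R n \x lebesgue_Rn R n)%E H)%E).
    by rewrite EFinM lee_wpmul2l// lee_fin.
  apply: (product_measure_sections_le H _ d (fun z => cabs (g z)) mH mball).
  - by move=> p /HG/GEF[/EB'].
  - exact: d0.
  - rewrite (_ : (fun _ => _) = (@Num.norm _ R) \o h); last first.
      by apply/funext => z; rewrite /g cabs_real.
    by apply: measurableT_comp; [exact: normr_measurable|exact: measurable_funTS mh].
  move=> z _; rewrite /g cabs_real.
  (* Outside [E \ Q] the section of [H] is empty, since [H] lies in [G] and avoids [Q], and the
     bound is trivial. *)
  have [[zE zQ]|zEQ] := pselect ((E `\` Q) z); last first.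
    rewrite (_ : xsection H z = set0) ?measure0 ?mule0 ?lee_fin//.
    apply/seteqP; split=> u //; rewrite /xsection/= inE => Hzu; apply: zEQ.
    by split; [have [] := GEF _ (HG _ Hzu)|exact: HQ Hzu].
  rewrite indicE mem_set// mulr1.
  apply: (@commutator_indic_ge R n hn ball_finite b Omega F z r0 L) => //.
  - by exists x1, r0.
  - by move=> u; exact: distE.
  - exact: measurable_xsection.
  - by move=> u; rewrite /xsection/= inE => /HG/GEF[].
  - by case: sO => sO; [left|right] => u Fu; exact: (sO (z, u)).
  - by case: sb => sb; [left|right] => u Fu; exact: (sb (z, u)).
  - move=> u; rewrite /xsection/= inE => /HG/GEF[Ez Fu].
    by rewrite -lee_fin -wE; exact: oscle.
  - by move=> u; rewrite /xsection/= inE => /HG; exact: epsG.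
have max_ge z : F z -> ((w * c)%:E <= maximal g z)%E.
  (* The ball of centre [x0] and radius [L] contains [F], so it competes in the supremum at every
     point of [F]. *)
  move=> /FB' zB; apply: le_trans (maximal_ge _ _ _ _ L0 zB).
  rewrite lebesgue_eball// vE -EFinM /=.
  apply: (@le_trans _ _ ((L ^+ n * v)^-1%:E *
      (d * (lambda / 16 * beta ^+ 2))%:E)%E); last first.
    by rewrite lee_wpmul2l// lee_fin invr_ge0 mulr_ge0 ?exprn_ge0// ltW.
  rewrite -EFinM lee_fin le_eqVlt; apply/orP; left; apply/eqP.
  rewrite /c /d /beta /L !exprMn.
  have Kn : K ^+ n != 0 by rewrite expf_neq0// gt_eqF.
  have rn : r0 ^+ n != 0 by rewrite expf_neq0// gt_eqF.
  by field; rewrite Kn rn gt_eqF.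
have wc0 : 0 <= w * c by rewrite mulr_ge0// ltW.
have key := bbfs_maximal_indic hX CM F x0 L (w * c) g MC L0 mF FB' Xg wc0 max_ge.
rewrite wE (_ : w = c^-1 * (w * c)); last by rewrite mulrCA mulVf ?mulr1// gt_eqF.
rewrite [CM / c]mulrC (EFinM _ (w * c)) (EFinM _ CM) -!muleA.
by rewrite lee_wpmul2l// lee_fin invr_ge0 ltW.
Qed.
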